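(* Let $\lambda>0$ and consider the synchronized soft-policy risk-sensitive stochastic optimal control problem $$\min_{\underline{\pi}}\min_{\underline{\tau}}\ \mathbb{E}_{p_{(\underline{\pi},\underline{\tau})}}\Bigl[\underline{c}_T+\tfrac1\lambda\sum_{t=0}^{T-1}\log\tfrac{\pi_t}{\rho_t}+\tfrac1\lambda\sum_{t=0}^{T-1}\log\tfrac{\tau_t}{\iota_t}\Bigr],$$ with optimal value functions $V_t$, optimal policy $\pi_t^*$, desirability $z_t=e^{-\lambda V_t}$ and reward $r_t=e^{-\lambda c_t}$. Suppose the terminal cost decomposes as $$e^{-\lambda c_T}=\sum_{n=1}^N\gamma_n e^{-\lambda c_T^{(n)}}$$ with weights $\gamma_n>0$, and for each $n=1,\dots,N$ define the component desirabilities recursively by $$z_T^{(n)}:=\gamma_n e^{-\lambda c_T^{(n)}},\qquad z_t^{(n)}:=\mathbb{E}_{\rho_t}\bigl[r_t\,\mathbb{E}_{\iota_t}[z_{t+1}^{(n)}]\bigr],\quad t=T-1,\dots,0.$$ Then, for all $t=0,\dots,T-1$, the desirability and the optimal policy admit the decompositions $$z_t=\sum_{n=1}^N z_t^{(n)},\qquad \pi_t^*=\sum_{n=1}^N w_t^{(n)}\pi_t^{(n)},$$ with mixture weights $w_t^{(n)}=z_t^{(n)}/z_t$, $\sum_{n=1}^N w_t^{(n)}=1$, and component policies $$\pi_t^{(n)}=\rho_t\,\frac{r_t\,\mathbb{E}_{\iota_t}[z_{t+1}^{(n)}]}{z_t^{(n)}}.$$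
   Context: Setting: a discrete-time controlled stochastic system with finite horizon $T$, states $x_t$, actions $u_t$, and trajectories $\underline{\xi}_T=(x_0,u_0,\dots,x_{T-1},u_{T-1},x_T)$. A policy sequence $\underline{\pi}=(\pi_0,\dots,\pi_{T-1})$ consists of conditional distributions $\pi_t(u_t\mid x_t)$; a transition-kernel sequence $\underline{\tau}=(\tau_0,\dots,\tau_{T-1})$ consists of conditional distributions $\tau_t(x_{t+1}\mid x_t,u_t)$. They induce the trajectory distribution $p_{(\underline{\pi},\underline{\tau})}(\underline{\xi}_T)=p(x_0)\prod_{t=0}^{T-1}\pi_t(u_t\mid x_t)\,\tau_t(x_{t+1}\mid x_t,u_t)$, with a fixed initial state distribution $p(x_0)$. The fixed baseline consists of a reference policy sequence $\underline{\rho}=(\rho_t)$ and the system's true transition kernels $\underline{\iota}=(\iota_t)$; decision variables are required to be absolutely continuous with respect to the baseline ($\pi_t\ll\rho_t$, $\tau_t\ll\iota_t$). Costs: $\underline{c}_T(\underline{\xi}_T)=\sum_{t=0}^{T-1}c_t(x_t,u_t)+c_T(x_T)$ with running costs $c_t\ge 0$ and terminal cost $c_T\ge 0$. The component terminal costs $c_T^{(n)}$ are functions of $x_T$. Standing assumption: all trajectory expectations and risk operators that appear are finite for the policies and transitions considered. Notation: $\mathbb{D}^{\mu}_{\sigma}=\mathbb{E}_\mu[\log\frac{\mu}{\sigma}]$ is the Kullback-Leibler divergence, taken conditionally for kernels. $\mathbb{E}_{\rho_t}$ denotes expectation over $u_t\sim\rho_t(\cdot\mid x_t)$ and $\mathbb{E}_{\iota_t}$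 expectation over $x_{t+1}\sim\iota_t(\cdot\mid x_t,u_t)$. $r_t$ is a function of $(x_t,u_t)$; $V_t$, $z_t$, $z_t^{(n)}$, $w_t^{(n)}$ are functions of $x_t$; policies are functions of $u_t$ given $x_t$. Optimal value function: $V_T=c_T$ and, for $t<T$, $V_t(x_t)$ is the minimum over $(\pi_k,\tau_k)_{k=t}^{T-1}$ of $\mathbb{E}\bigl[c_T+\sum_{k=t}^{T-1}\bigl(c_k+\frac1\lambda\mathbb{D}^{\pi_k}_{\rho_k}+\frac1\lambda\mathbb{D}^{\tau_k}_{\iota_k}\bigr)\bigr]$ over the trajectory segment from $t$ to $T$ generated by $(\pi_k,\tau_k)_{k\ge t}$ given $x_t$. The optimal policy $\pi_t^*$ is the stage-$t$ minimiser $\pi_t^*=\arg\min_{\pi_t}\{\mathbb{E}_{\pi_t}[Q_t]+\frac1\lambda\mathbb{D}^{\pi_t}_{\rho_t}\}$, where $Q_t(x_t,u_t)=\min_{\tau_t}\{\mathbb{E}_{\tau_t}[c_t+V_{t+1}]+\frac1\lambda\mathbb{D}^{\tau_t}_{\iota_t}\}$. *)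

(* Defs.v *)
From HB Require Import structures.
From mathcomp Require Import all_boot all_order all_algebra.
From mathcomp Require Import all_classical all_reals all_analysis.
From mathcomp Require Import measurable_realfun.
Set Implicit Arguments.
Unset Strict Implicit.
Unset Printing Implicit Defensive.
Import Order.TTheory GRing.Theory Num.Theory.
Import numFieldNormedType.Exports.
Local Open Scope classical_set_scope.
Local Open Scope ring_scope.
Local Open Scope charge_scope.
Local Open Scope ereal_scope.

Section conditional_law.
Context d d' (X : measurableType d) (Y : measurableType d') (R : realType).
Variables (k : R.-pker X ~> Y) (x : X).

(* The library types [k x] only as a measure; this is [k x] as a
   probability. *)
Definition condlaw : set Y -> \bar R := k x.

HB.instance Definition _ := Measure.copy condlaw (k x).
HB.instance Definition _ :=
  Measure_isProbability.Build _ _ _ condlaw (prob_kernel x).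

End conditional_law.

Section kernel_composition.
Context d1 d2 d3 (X : measurableType d1) (Y : measurableType d2)
  (Z : measurableType d3) (R : realType).

Section pker_snd.
Variable k : R.-pker Y ~> Z.

Definition pker_snd : X * Y -> {measure set Z -> \bar R} := k \o snd.

Let measurable_pker_snd A : measurable A ->
  measurable_fun [set: X * Y] (pker_snd ^~ A).
Proof.
move=> mA.
by apply: (measurableT_comp (measurable_kernel k A mA)); exact: measurable_snd.
Qed.

HB.instance Definition _ :=
  isKernel.Build _ _ _ _ _ pker_snd measurable_pker_snd.

Let prob_pker_snd xy : pker_snd xy [set: Z] = 1.
Proof. exact: prob_kernel. Qed.

HB.instance Definition _ :=
  Kernel_isProbability.Build _ _ _ _ _ pker_snd prob_pker_snd.

End pker_snd.

Section pker_comp.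
Variables (l : R.-pker X ~> Y) (k : R.-pker (X * Y) ~> Z).

(* The library shows that [mkcomp l k] is a finite kernel, but not that it is a
   probability kernel when [l] and [k] are. *)
Definition pker_comp : X -> {measure set Z -> \bar R} := mkcomp l k.

HB.instance Definition _ := isKernel.Build _ _ _ _ _ pker_comp
  (KCOMP_FINITE_KERNEL.measurable_fun_kcomp_finite l k).

Let prob_pker_comp x : pker_comp x [set: Z] = 1.
Proof.
rewrite /pker_comp /= /kcomp.
under eq_integral do rewrite prob_kernel.
by rewrite integral_cst// mul1e; exact: prob_kernel.
Qed.

HB.instance Definition _ :=
  Kernel_isProbability.Build _ _ _ _ _ pker_comp prob_pker_comp.

End pker_comp.
End kernel_composition.

Section divergence.
Context d d' (X : measurableType d) (Y : measurableType d') (R : realType).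

Definition kl (mu nu : probability Y R) : \bar R :=
  \int[mu]_y lne (('d (charge_of_finite_measure mu) '/d nu) y).

(* Absolute continuity of conditional distributions.  The likelihood ratio of
   [k] and [h] is to be a function of [(x, y)] that can be integrated along a
   trajectory, so its versions for the various [x] are required to fit together
   into a jointly measurable function; this is automatic between standard Borel
   spaces. *)
Definition kernel_ac (k h : R.-pker X ~> Y) : Prop :=
  (forall x, condlaw k x `<< condlaw h x) /\
  exists2 f : X * Y -> \bar R, measurable_fun [set: X * Y] f &
    forall x, {ae condlaw h x, forall y,
      ('d (charge_of_finite_measure (condlaw k x)) '/d (condlaw h x)) y =
      f (x, y)}.

End divergence.

Section trajectories.
Context dX dU (X : measurableType dX) (U : measurableType dU) (R : realType).

(* A trajectory with [n] steps: the pairs (state, action) of these steps, and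
   the final state. *)
Notation traj n := (n.-tuple (X * U) * X)%type.

Definition traj_cons n (v : X * U * X * traj n) : traj n.+1 :=
  ([tuple of v.1.1 :: v.2.1], v.2.2).

Lemma measurable_traj_cons n :
  measurable_fun [set: X * U * X * traj n] (@traj_cons n).
Proof.
apply/measurable_fun_pairP; split.
  apply: measurable_cons; first exact: measurableT_comp.
  exact: (measurableT_comp measurable_fst measurable_snd).
exact: (measurableT_comp measurable_snd measurable_snd).
Qed.

Lemma measurable_traj0 :
  measurable_fun [set: X] (fun x : X => ([tuple], x) : traj 0).
Proof. by apply: measurable_fun_pair => //; exact: measurable_cst. Qed.

(* The law of the trajectory of the [n] steps [t, ..., t + n - 1], given the
   state at time [t]: draw [u] from [pi t x], then [y] from [tau t (x, u)], then
   the rest of the trajectory from [y], and prepend [(x, u)]. *)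
Fixpoint traj_law (pi : nat -> R.-pker X ~> U) (tau : nat -> R.-pker X * U ~> X)
    (n t : nat) : R.-pker X ~> traj n :=
  match n with
  | 0 => kdirac measurable_traj0
  | n'.+1 => pker_comp (pi t) (pker_comp (tau t)
      (pker_comp (pker_snd (traj_law pi tau n' t.+1))
                 (kdirac (@measurable_traj_cons n'))))
  end.

End trajectories.

Section control_problem.
Context dX dU (X : measurableType dX) (U : measurableType dU) (R : realType).
Variables (T : nat) (lambda : R).
Variables (rho : nat -> R.-pker X ~> U) (iota : nat -> R.-pker X * U ~> X).
Variables (c : nat -> X * U -> R) (cT : X -> R).

Definition admissible (t : nat) (pi : nat -> R.-pker X ~> U)
    (tau : nat -> R.-pker X * U ~> X) : Prop :=
  forall k, (t <= k < T)%N ->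
    kernel_ac (pi k) (rho k) /\ kernel_ac (tau k) (iota k).

Definition objective (t : nat) (pi : nat -> R.-pker X ~> U)
    (tau : nat -> R.-pker X * U ~> X) (x : X) : \bar R :=
  \int[traj_law pi tau (T - t) t x]_xi
    ((cT xi.2)%:E + \sum_(k < T - t)
      let xu := tnth xi.1 k in
      ((c (t + k)%N xu)%:E
       + lambda^-1%:E *
         kl (condlaw (pi (t + k)%N) xu.1) (condlaw (rho (t + k)%N) xu.1)
       + lambda^-1%:E *
         kl (condlaw (tau (t + k)%N) xu) (condlaw (iota (t + k)%N) xu))).

Definition objective_values (t : nat) (x : X) : set (\bar R) :=
  [set J | exists pi tau, admissible t pi tau /\ J = objective t pi tau x].

(* Well defined without assuming that the minimum is attained, which is
   asserted separately; likewise for [Qfun]. *)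
Definition value (t : nat) (x : X) : \bar R :=
  ereal_inf (objective_values t x).

Definition Q_values (t : nat) (x : X) (u : U) : set (\bar R) :=
  [set J | exists nu : probability X R, nu `<< condlaw (iota t) (x, u) /\
    J = \int[nu]_y ((c t (x, u))%:E + value t.+1 y)
        + lambda^-1%:E * kl nu (condlaw (iota t) (x, u))].

Definition Qfun (t : nat) (x : X) (u : U) : \bar R :=
  ereal_inf (Q_values t x u).

Definition stage_objective (t : nat) (x : X) (nu : probability U R) : \bar R :=
  \int[nu]_u Qfun t x u + lambda^-1%:E * kl nu (condlaw (rho t) x).

Definition optimal_policy (t : nat) (pi : R.-pker X ~> U) : Prop :=
  forall x, condlaw pi x `<< condlaw (rho t) x /\
    forall nu : probability U R, nu `<< condlaw (rho t) x ->
      stage_objective t x (condlaw pi x) <= stage_objective t x nu.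

Definition desirability (t : nat) (x : X) : \bar R :=
  expeR (- (lambda%:E * value t x)).

Definition reward (t : nat) (x : X) (u : U) : \bar R :=
  (expR (- (lambda * c t (x, u))))%:E.

End control_problem.

(* Main.v *)
Require Import Defs.
From HB Require Import structures.
From mathcomp Require Import all_boot all_order all_algebra.
From mathcomp Require Import all_classical all_reals all_analysis.
From mathcomp Require Import measurable_realfun.
From mathcomp Require Import ring lra.
Set Implicit Arguments.
Unset Strict Implicit.
Unset Printing Implicit Defensive.
Import Order.TTheory GRing.Theory Num.Theory.
Import numFieldNormedType.Exports.
Local Open Scope classical_set_scope.
Local Open Scope ring_scope.
Local Open Scope charge_scope.
Local Open Scope ereal_scope.

(** The desirability recursion is linear, and a sum of solutions of a linear
    recursion solves it with the sum of the terminal conditions.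

    The nonlinear minimisation turns into a linear recursion because of the
    Gibbs variational principle.  For a probability [nu] and a measurable
    [F >= 0], the minimum over [mu `<< nu] of
    [E_mu F + lambda^-1 * KL(mu | nu)] is [- lambda^-1 * ln Z] with
    [Z = E_nu (exp (- lambda F))], and it is reached at the tilted law of
    density [exp (- lambda F) / Z] with respect to [nu], and only there
    ([gibbs_variational], [gibbs_attained]).  One stage of the control problem
    consists of two such minimisations: over the law of the next state, with
    [F = c_t + V_{t+1}], and then over the law of the action, with [F = Q_t].
    Written for [exp (- lambda Q_t)] and [z_t = exp (- lambda V_t)] they read
    [exp (- lambda Q_t) = r_t E_iota z_{t+1}] and
    [z_t = E_rho (r_t E_iota z_{t+1})], so that [z] is computed backwards in
    time by a linear operator ([backup], [backup_sum]), and the unique optimal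
    policy has density [r_t E_iota z_{t+1} / z_t] with respect to [rho_t].
    Splitting the numerator of this density along [z = sum_n z^(n)] exhibits the
    optimal policy as the mixture of the component policies.

    The value is defined by one integral over whole trajectories, so it has to
    be shown that this integral can be computed stage by stage
    ([expected_costS]).  All the costs are nonnegative, the divergences included
    ([kl_ge0]), hence no integrability is required; what is required is that
    [x |-> KL(pi(x) | rho(x))] be measurable, which follows from the joint
    measurability of the likelihood ratio ([measurable_kl_kernel]).  Given the
    recursion, the one-stage inequality [bellman_le] and its equality case
    [bellman_eq] identify the value function by backward induction
    ([value_attained]).

    The Kullback-Leibler divergence can be infinite, and the likelihood ratio
    [f] of [mu] with respect to [nu] can vanish.  The variational principle is
    therefore proved by integrating with respect to [mu] only, with the help of
    a positive version of [1 / f] ([kl_reverse_density]). *)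

(** * The logarithm *)

Section real_inequalities.
Context (R : realType).

Lemma one_sub_le_Nln (s : R) : (0 < s)%R -> (1 - s <= - ln s)%R.
Proof.
move=> s0; have := @le_ln1Dx R (s - 1)%R.
by rewrite (_ : (1 + (s - 1))%R = s); [move=> /(_ ltac:(lra)); lra|ring].
Qed.

(** The equality case of the previous inequality; it is the source of the
    uniqueness of the optimal policy. *)
Lemma one_sub_eq_Nln (s : R) : (0 < s)%R -> (1 - s = - ln s)%R -> s = 1%R.
Proof.
move=> s0 e; apply: contrapT => /eqP s1.
have ls0 : (ln s != 0)%R by rewrite ln_eq0.
by have := expR_gt1Dx ls0; rewrite lnK ?posrE// -[ln s]opprK -e; lra.
Qed.

Lemma measurable_lne : measurable_fun [set: \bar R] (@lne R).
Proof.
have -> : @lne R = (fun x => if x == +oo then +oo else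
    if x <= 0 then -oo else (ln (fine x))%:E).
  by apply/funext => -[r| |] //; rewrite ?leNye.
apply: measurable_fun_ifT.
- by apply: measurable_fun_eqe; [exact: measurable_id|exact: measurable_cst].
- exact: measurable_cst.
- apply: measurable_fun_ifT.
  + by apply: measurable_fun_lee; [exact: measurable_id|exact: measurable_cst].
  + exact: measurable_cst.
  + apply/measurable_EFinP; apply: measurableT_comp => //.
Qed.

End real_inequalities.

(** * The Kullback-Leibler divergence and the Gibbs variational principle *)

Section kl_of_version.
Context d (Y : measurableType d) (R : realType).

Lemma kl_ae_eq (mu nu : probability Y R) (f : Y -> \bar R) :
  mu `<< nu -> measurable_fun [set: Y] f ->
  ae_eq nu [set: Y] ('d (charge_of_finite_measure mu) '/d nu) f ->
  kl mu nu = \int[mu]_y lne (f y).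
Proof.
move=> munu mf RNf; apply: ae_eq_integral => //.
- apply: measurableT_comp => //; exact: measurable_lne.
- by apply: measurableT_comp; first exact: measurable_lne.
- have := null_dominates_ae_eq measurableT munu RNf.
  by apply: filterS => y /(_ Logic.I) ->.
Qed.

End kl_of_version.

Section reverse_density.
Context d (Y : measurableType d) (R : realType).
Implicit Types (mu nu : probability Y R).

(** The function [k] is a positive version of the density of [nu] with respect
    to [mu].  The last relation is only an inequality because [nu] may charge
    the set where the density of [mu] vanishes. *)
Lemma kl_reverse_density mu nu : mu `<< nu -> exists k : Y -> R,
  [/\ measurable_fun [set: Y] k, (forall y, (0 < k y)%R),
      kl mu nu = \int[mu]_y (- ln (k y))%:E &
      forall (phi : Y -> \bar R) A, measurable A ->
        measurable_fun [set: Y] phi -> (forall y, 0 <= phi y) ->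
        \int[mu]_(y in A) (phi y * (k y)%:E) <= \int[nu]_(y in A) phi y].
Proof.
move=> munu.
pose f := Radon_Nikodym_SigmaFinite.f mu nu.
have f0 y : 0 <= f y by exact: Radon_Nikodym_SigmaFinite.f_ge0.
have ffin y : f y \is a fin_num by exact: Radon_Nikodym_SigmaFinite.f_fin_num.
have fi : nu.-integrable [set: Y] f
  by exact: Radon_Nikodym_SigmaFinite.f_integrable.
have mf : measurable_fun [set: Y] f := measurable_int _ fi.
(* This is [1 / f] where [f > 0]; since [ln 0 = 0], it is 1 where [f = 0]. *)
pose k y := expR (- ln (fine (f y))).
have mln : measurable_fun [set: Y] (fun y => ln (fine (f y))).
  apply: measurableT_comp => //; apply: measurableT_comp => //.
have k0 y : (0 < k y)%R by exact: expR_gt0.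
have mk : measurable_fun [set: Y] k.
  by apply: measurableT_comp => //; exact: measurableT_comp.
exists k; split => //.
- have mf0 : measurable [set y | f y = 0].
    rewrite -[X in measurable X]setTI.
    exact: (mf measurableT [set 0] (emeasurable_set1 0)).
  have mul0 : mu [set y | f y = 0] = 0.
    by rewrite (Radon_Nikodym_SigmaFinite.f_integral munu)// integral0_eq.
  apply: ae_eq_integral => //.
  + by apply: measurableT_comp; [exact: measurable_lne|].
  + apply/measurable_EFinP; apply: measurableT_comp => //.
    exact: measurableT_comp.
  + have := null_dominates_ae_eq measurableT munu
      (ae_eq_Radon_Nikodym_SigmaFinite munu measurableT).
    have : {ae mu, forall y, f y <> 0}.
      by exists [set y | f y = 0]; split => // y /= /contrapT.
    apply: filterS2 => y fy0 /(_ Logic.I) <- _.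
    rewrite -/f /k expRK opprK -{1}(fineK (ffin y)) lne_EFin//.
    rewrite fine_gt0// ltey_eq ffin lt_neqAle f0 eq_sym/=.
    by move/eqP : fy0 => ->.
- move=> phi A mA mphi phi0.
  rewrite -(Radon_Nikodym_SigmaFinite.change_of_variables munu)//; last 2 first.
  + by move=> y; rewrite mule_ge0// lee_fin ltW.
  + apply: measurable_funTS; apply: emeasurable_funM => //.
    exact/measurable_EFinP.
  apply: ge0_le_integral => //.
  + by move=> y _; rewrite !mule_ge0// lee_fin ltW.
  + apply: measurable_funTS; apply: emeasurable_funM => //.
    by apply: emeasurable_funM => //; exact/measurable_EFinP.
  + exact: measurable_funTS.
  + move=> y _; rewrite /= -muleA -/f /k.
    have [->|fy0] := eqVneq (f y) 0; first by rewrite !mule0.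
    have fy : (0 < fine (f y))%R.
      by rewrite fine_gt0// ltey_eq ffin lt_neqAle f0 eq_sym fy0.
    by rewrite expRN lnK// -{2}(fineK (ffin y)) -EFinM mulVf ?mule1// gt_eqF.
Qed.

End reverse_density.

Section gibbs.
Context d (Y : measurableType d) (R : realType).
Implicit Types (mu nu : probability Y R).

Lemma integral_prob_cst mu (r : \bar R) : \int[mu]_y r = r.
Proof.
rewrite integral_cst//; transitivity (r * 1); last exact: mule1.
by congr (_ * _); exact: probability_setT.
Qed.

(** The negative part of the integrand [- ln k] is at most [k], whose integral
    is at most 1. *)
Lemma kl_gtNy mu nu : mu `<< nu -> -oo < kl mu nu.
Proof.
move=> munu; have [k [mk k0 klE kle]] := kl_reverse_density munu.
have mL : measurable_fun [set: Y] (fun y => (- ln (k y))%:E).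
  apply/measurable_EFinP; apply: measurableT_comp => //.
  exact: measurableT_comp.
have neg1 : \int[mu]_y ((fun y => (- ln (k y))%:E)^\- y) <= 1.
  rewrite -[leRHS](integral_prob_cst nu).
  apply: le_trans (kle (cst 1) setT measurableT _ _) => //.
  apply: ge0_le_integral => //.
  - exact: measurable_funeneg.
  - by apply: emeasurable_funM => //; exact/measurable_EFinP.
  - move=> y _; rewrite mul1e funenegE -EFinN opprK -EFin_max lee_fin.
    by rewrite ge_max (ltW (k0 y)) andbT ltW// ln_sublinear.
rewrite klE integralE (lt_le_trans (ltNyr (-1)))// (@le_trans _ _ (0 - 1))//.
  by rewrite sub0e.
by apply: leeB => //; exact: integral_ge0.
Qed.

(** With [h := exp (- E) / Z], the density of the Gibbs law, and [k] the reverse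
    density of [mu], the difference of the two sides is the integral of
    [- ln (h k)] with respect to [mu].  Now [- ln (h k) >= 1 - h k], and the
    right-hand side has a nonnegative integral because [h k] has integral at
    most 1.  In the case of equality, [h k = 1] almost everywhere for [mu], so
    [mu A <= \int[nu]_(y in A) h y] for every [A]; as both sides are
    probabilities, they are equal.

    The energy is taken nonnegative so that [\int[mu]_y E y] makes sense even
    when it is infinite. *)
Lemma gibbs_variational mu nu (E : Y -> R) (Z : R) : mu `<< nu ->
  measurable_fun [set: Y] E -> (forall y, (0 <= E y)%R) -> (0 < Z)%R ->
  \int[nu]_y (expR (- E y))%:E = Z%:E ->
  (- ln Z)%:E <= \int[mu]_y (E y)%:E + kl mu nu /\
  (\int[mu]_y (E y)%:E + kl mu nu = (- ln Z)%:E ->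
   forall A, measurable A -> mu A = \int[nu]_(y in A) (expR (- E y) / Z)%:E).
Proof.
move=> munu mE E0 Z0 EZ.
have klNy := kl_gtNy munu.
have [k [mk k0 klE kle]] := kl_reverse_density munu.
have mL : measurable_fun [set: Y] (fun y => (- ln (k y))%R).
  by apply: measurableT_comp => //; exact: measurableT_comp.
have iE0 : 0 <= \int[mu]_y (E y)%:E.
  by apply: integral_ge0 => y _; rewrite lee_fin.
have [iEy|iEfin] := eqVneq (\int[mu]_y (E y)%:E) +oo.
  by rewrite iEy addye ?gt_eqF//; split => //; rewrite leey.
have [kly|klfin] := eqVneq (kl mu nu) +oo.
  rewrite kly addey; last by rewrite gt_eqF// (lt_le_trans _ iE0)// ltNy0.
  by split => //; rewrite leey.
have {}iEfin : \int[mu]_y (E y)%:E \is a fin_num.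
  by rewrite ge0_fin_numE// ltey.
have {}klfin : kl mu nu \is a fin_num.
  by rewrite fin_numE klfin andbT gt_eqF.
have iE : mu.-integrable [set: Y] (EFin \o E).
  apply/integrableP; split; first exact/measurable_EFinP.
  by rewrite integral_fin_num_abs.
have iL : mu.-integrable [set: Y] (EFin \o (fun y => - ln (k y))%R).
  apply/integrableP; split; first exact/measurable_EFinP.
  by rewrite integral_fin_num_abs// -klE.
pose h y := (expR (- E y) / Z)%R.
have h0 y : (0 < h y)%R by rewrite divr_gt0// expR_gt0.
have mh : measurable_fun [set: Y] h.
  apply: measurable_funM => //; apply: measurableT_comp => //.
  exact: measurableT_comp.
have ih A : measurable A ->
    \int[mu]_(y in A) (h y * k y)%:E <= \int[nu]_(y in A) (h y)%:E.
  move=> mA; apply: le_trans (kle (EFin \o h) A mA _ _) => //.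
  - exact/measurable_EFinP.
  - by move=> y; rewrite lee_fin ltW.
have ih1 : \int[nu]_y (h y)%:E = 1.
  under eq_integral do rewrite EFinM.
  rewrite ge0_integralZr ?lee_fin ?invr_ge0 ?(ltW Z0)//; last first.
    apply/measurable_EFinP; apply: measurableT_comp => //.
    exact: measurableT_comp.
  by rewrite EZ -EFinM mulfV// gt_eqF.
have hk1 : \int[mu]_y (h y * k y)%:E <= 1 by rewrite -ih1; exact: ih.
have mhk : measurable_fun [set: Y] (fun y => h y * k y)%R.
  exact: measurable_funM.
have hk0 y : (0 <= h y * k y)%R by rewrite ltW// mulr_gt0.
have hkfin : \int[mu]_y (h y * k y)%:E \is a fin_num.
  rewrite ge0_fin_numE ?(le_lt_trans hk1) ?ltry//.
  by apply: integral_ge0 => y _; rewrite lee_fin.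
have ihk : mu.-integrable [set: Y] (EFin \o (fun y => h y * k y)%R).
  apply/integrableP; split; first exact/measurable_EFinP.
  by rewrite integral_fin_num_abs.
(* The gap between [- ln (h k)] and [1 - h k], expanded so as to be integrated
   term by term. *)
pose D y := (E y + (- ln (k y)) + (ln Z - 1) + h y * k y)%R.
have DE y : D y = (- ln (h y * k y) - (1 - h y * k y))%R.
  rewrite /D /h !lnM ?posrE ?mulr_gt0 ?invr_gt0 ?expR_gt0//.
  by rewrite expRK lnV ?posrE//; ring.
have mD : measurable_fun [set: Y] D.
  by do 3 (apply: measurable_funD => //).
have D0 y : (0 <= D y)%R.
  by rewrite DE subr_ge0 one_sub_le_Nln// mulr_gt0.
have iD : \int[mu]_y (D y)%:E = \int[mu]_y (E y)%:E + kl mu nu + (ln Z - 1)%:E +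
    \int[mu]_y (h y * k y)%:E.
  have icst : mu.-integrable [set: Y] (EFin \o cst (ln Z - 1)%R).
    by apply: finite_measure_integrable_cst.
  under eq_integral do rewrite !EFinD.
  rewrite integralD//; last by apply: integrableD => //; exact: integrableD.
  rewrite integralD//; last exact: integrableD.
  rewrite integralD// -klE.
  by congr (_ + _ + _); exact: integral_prob_cst.
have iD_ge0 : 0 <= \int[mu]_y (D y)%:E.
  by apply: integral_ge0 => y _; rewrite lee_fin.
move: (iD_ge0) (hk1); rewrite iD -(fineK iEfin) -(fineK klfin) -(fineK hkfin).
rewrite -!EFinD !lee_fin => iD_ge0' hk1'; split; first by lra.
case=> eq0 A mA.
have D0ae : ae_eq mu setT (EFin \o D) (cst 0).
  have iD0 : \int[mu]_y (D y)%:E = 0.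
    apply/eqP; rewrite eq_le iD_ge0 andbT iD -(fineK iEfin) -(fineK klfin).
    by rewrite -(fineK hkfin) -!EFinD lee_fin; lra.
  apply/ae_eq_integral_abs => //; first exact/measurable_EFinP.
  by under eq_integral do rewrite gee0_abs ?lee_fin//.
have hkae : ae_eq mu setT (fun y => (h y * k y)%:E) (cst 1).
  apply: filterS D0ae => y /(_ Logic.I)[] /eqP.
  rewrite DE subr_eq0 => /eqP Dy _.
  by rewrite (@one_sub_eq_Nln _ (h y * k y))// mulr_gt0.
have le_h B : measurable B -> mu B <= \int[nu]_(y in B) (h y)%:E.
  move=> mB; apply: le_trans (ih B mB).
  rewrite -[leLHS]mul1e -integral_cst// le_eqVlt; apply/orP; left; apply/eqP.
  apply: ge0_ae_eq_integral => //.
  - by apply/measurable_EFinP; exact: measurable_funTS.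
  - by move=> y _; rewrite lee_fin.
  - by apply: filterS hkae => y /(_ Logic.I) ->.
(* The reverse inequality is [le_h] on the complement of [A]. *)
apply/eqP; rewrite eq_le le_h//=.
have := le_h _ (measurableC mA); rewrite probability_setC//.
have := ih1; rewrite -(setUv A) ge0_integral_setU//; last 4 first.
- exact: measurableC.
- by rewrite setUv; exact/measurable_EFinP.
- by move=> y _; rewrite lee_fin ltW.
- exact/disj_setPCl.
rewrite -(fineK (fin_num_measure mu _ mA)) => ab1 leb.
have a0 : 0 <= \int[nu]_(y in A) (h y)%:E.
  by apply: integral_ge0 => y _; rewrite lee_fin ltW.
have b0 : 0 <= \int[nu]_(y in ~` A) (h y)%:E.
  by apply: integral_ge0 => y _; rewrite lee_fin ltW.
move: a0 b0 ab1 leb; rewrite -/h.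
case: (\int[nu]_(y in A) _) => // a; case: (\int[nu]_(y in ~` A) _) => // b.
by move=> _ _ [ab1]; rewrite -EFinB !lee_fin; lra.
Qed.

(** The variational principle for the zero energy. *)
Lemma kl_ge0 mu nu : mu `<< nu -> 0 <= kl mu nu.
Proof.
move=> munu.
have [] := gibbs_variational (E := cst 0%R) (Z := 1%R) munu.
- exact: measurable_cst.
- by [].
- by [].
- under eq_integral do rewrite /= oppr0 expR0.
  exact: integral_prob_cst.
- by rewrite ln1 oppr0 integral0 add0e => -[].
Qed.

End gibbs.

Section density.
Context d (Y : measurableType d) (R : realType).
Variables (mu nu : probability Y R) (h : Y -> R).
Hypotheses (mh : measurable_fun [set: Y] h) (h0 : forall y, (0 < h y)%R).
Hypothesis muE : forall A, measurable A -> mu A = \int[nu]_(y in A) (h y)%:E.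

Lemma density_dominates : mu `<< nu.
Proof.
apply/null_content_dominatesP => A mA nuA.
rewrite muE//; apply: null_set_integral => //.
  exact/measurable_EFinP/measurable_funTS.
Qed.

Lemma density_Radon_Nikodym :
  ae_eq nu [set: Y] ('d (charge_of_finite_measure mu) '/d nu) (EFin \o h).
Proof.
have munu := density_dominates.
apply: integral_ae_eq => //.
- exact: Radon_Nikodym_integrable.
- exact/measurable_EFinP.
- by move=> A _ mA; rewrite -Radon_Nikodym_integral//; exact: muE.
Qed.

Lemma kl_density : kl mu nu = \int[mu]_y (ln (h y))%:E.
Proof.
rewrite (kl_ae_eq density_dominates _ density_Radon_Nikodym).
  by apply: eq_integral => y _; exact: lne_EFin.
exact/measurable_EFinP.
Qed.

End density.

(** * The Gibbs law reaches the minimum *)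

Section gibbs_attained.
Context d (Y : measurableType d) (R : realType).
Variables (mu nu : probability Y R) (E : Y -> R) (Z : R).
Hypotheses (mE : measurable_fun [set: Y] E) (E0 : forall y, (0 <= E y)%R).
Hypotheses (Z0 : (0 < Z)%R).
Hypothesis muE : forall A, measurable A ->
  mu A = \int[nu]_(y in A) (expR (- E y) / Z)%:E.

(** Here [kl mu nu] is the integral of [- E - ln Z], but the energy has to be
    shown integrable before it cancels.  This comes for free: the divergence is
    not [-oo], and [- E - ln Z] is bounded above, so the divergence is
    finite. *)
Lemma gibbs_attained : \int[mu]_y (E y)%:E + kl mu nu = (- ln Z)%:E.
Proof.
have h0 y : (0 < expR (- E y) / Z)%R by rewrite divr_gt0// expR_gt0.
have mh : measurable_fun [set: Y] (fun y => expR (- E y) / Z)%R.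
  apply: measurable_funM => //; apply: measurableT_comp => //.
  exact: measurableT_comp.
have munu := density_dominates mh muE.
have klNy := kl_gtNy munu.
have klE : kl mu nu = \int[mu]_y (- E y - ln Z)%:E.
  rewrite (kl_density mh h0 muE); apply: eq_integral => y _.
  by rewrite lnM ?posrE ?invr_gt0 ?expR_gt0// expRK lnV.
have mf : measurable_fun [set: Y] (fun y => - E y - ln Z)%R.
  by apply: measurable_funD => //; exact: measurableT_comp.
have kly : kl mu nu < +oo.
  rewrite klE integralE.
  apply: (@le_lt_trans _ _ (\int[mu]_y `|(- ln Z)%:E|)); last first.
    by rewrite integral_prob_cst ltry.
  apply: (@le_trans _ _ (\int[mu]_y ((fun y => (- E y - ln Z)%:E)^\+ y))).
    by rewrite geeDl// oppe_le0 integral_ge0.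
  apply: ge0_le_integral => //.
  - by apply: measurable_funepos; exact/measurable_EFinP.
  - move=> y _; rewrite funeposE -EFin_max lee_fin ge_max normr_ge0 andbT.
    by rewrite (le_trans _ (ler_norm _))// gerDr oppr_le0.
have klfin : kl mu nu \is a fin_num by rewrite fin_numE gt_eqF//= lt_eqF.
have iF : mu.-integrable [set: Y] (EFin \o (fun y => - E y - ln Z)%R).
  apply/integrableP; split; first exact/measurable_EFinP.
  by rewrite integral_fin_num_abs// -klE.
have ic : mu.-integrable [set: Y] (EFin \o cst (- ln Z)%R).
  exact: finite_measure_integrable_cst.
have iE : \int[mu]_y (E y)%:E = (- ln Z)%:E - kl mu nu.
  rewrite klE -[X in X - _](integral_prob_cst mu) -integralB//.
  by apply: eq_integral => y _; rewrite -EFinB; congr (_%:E); ring.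
by rewrite iE subeK.
Qed.

End gibbs_attained.

(** * Tilted kernels *)

Section kernel_density.
Context dX dY (X : measurableType dX) (Y : measurableType dY) (R : realType).
Variables (k : R.-pker X ~> Y) (h : X * Y -> R).
Hypotheses (mh : measurable_fun [set: X * Y] h) (h0 : forall xy, (0 <= h xy)%R).
Hypothesis h1 : forall x, \int[k x]_y (h (x, y))%:E = 1.

Definition density_kernel x (A : set Y) := \int[k x]_(y in A) (h (x, y))%:E.

Let mhx x : measurable_fun [set: Y] (fun y => (h (x, y))%:E).
Proof. by apply/measurable_EFinP; apply: measurableT_comp. Qed.

Let density_kernel0 x : density_kernel x set0 = 0.
Proof. exact: integral_set0. Qed.

Let density_kernel_ge0 x A : 0 <= density_kernel x A.
Proof. by apply: integral_ge0 => y _; rewrite lee_fin. Qed.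

Let density_kernel_sigma_additive x : semi_sigma_additive (density_kernel x).
Proof.
move=> F mF tF mUF; rewrite /density_kernel ge0_integral_bigcup//.
- apply: is_cvg_ereal_nneg_natsum => n _; exact: density_kernel_ge0.
- exact: measurable_funTS.
- by move=> y _; rewrite lee_fin.
Qed.

HB.instance Definition _ x := isMeasure.Build _ _ _ (density_kernel x)
  (density_kernel0 x) (density_kernel_ge0 x) (@density_kernel_sigma_additive x).

(** The same function with values in measures, as the kernel structures
    demand. *)
Definition density_mkernel : X -> {measure set Y -> \bar R} := density_kernel.

Let measurable_density_kernel A : measurable A ->
  measurable_fun [set: X] (density_mkernel ^~ A).
Proof.
move=> mA; rewrite /density_mkernel /= /density_kernel.
under eq_fun do rewrite integral_mkcond.
apply: (measurable_fun_integral_finite_kernel (fun xy : X * Y =>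
  ((fun y => (h (xy.1, y))%:E) \_ A) xy.2)).
  by move=> [x y] /=; rewrite patchE; case: ifPn; rewrite ?lee_fin.
rewrite (_ : (fun xy => _) = (EFin \o h) \_ (setT `*` A)).
  apply/(measurable_restrictT _ _).1; first exact: measurableX.
  by apply: measurable_funTS; exact/measurable_EFinP.
by apply/funext => -[x y]; rewrite !patchE in_setX in_setT.
Qed.

HB.instance Definition _ := isKernel.Build _ _ _ _ _ density_mkernel
  measurable_density_kernel.

HB.instance Definition _ := Kernel_isProbability.Build _ _ _ _ _
  density_mkernel h1.

Definition density_pker : R.-pker X ~> Y := density_mkernel.

End kernel_density.

Section kernel_mean.
Context dX dY (X : measurableType dX) (Y : measurableType dY) (R : realType).
Variables (k : R.-pker X ~> Y) (s : X * Y -> R) (C : R).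
Hypotheses (ms : measurable_fun [set: X * Y] s) (s0 : forall xy, (0 < s xy)%R)
  (sC : forall xy, (s xy <= C)%R).

Definition kernel_mean x : R := fine (\int[k x]_y (s (x, y))%:E).

Let msx x : measurable_fun [set: Y] (fun y => (s (x, y))%:E).
Proof. by apply/measurable_EFinP; apply: measurableT_comp. Qed.

Let kernel_mean_ub x : \int[k x]_y (s (x, y))%:E <= C%:E.
Proof.
rewrite -[leRHS](integral_prob_cst (condlaw k x)); apply: ge0_le_integral => //.
- by move=> y _; rewrite lee_fin ltW.
- by move=> y _; rewrite lee_fin.
Qed.

Lemma kernel_meanE x : (kernel_mean x)%:E = \int[k x]_y (s (x, y))%:E.
Proof.
rewrite fineK// ge0_fin_numE ?(le_lt_trans (kernel_mean_ub x)) ?ltry//.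
by apply: integral_ge0 => y _; rewrite lee_fin ltW.
Qed.

Lemma kernel_mean_le x : (kernel_mean x <= C)%R.
Proof. by rewrite -lee_fin kernel_meanE. Qed.

(** If the mean were zero, the positive function [s] would vanish almost
    everywhere, and the whole space would be negligible. *)
Lemma kernel_mean_gt0 x : (0 < kernel_mean x)%R.
Proof.
rewrite -lte_fin kernel_meanE lt_neqAle integral_ge0 ?andbT; last first.
  by move=> y _; rewrite lee_fin ltW.
apply/eqP => /esym ints0.
have /ae_eq_integral_abs : \int[k x]_y `|(s (x, y))%:E| = 0.
  by under eq_integral do rewrite gee0_abs ?lee_fin ?ltW//.
move=> /(_ measurableT (msx x))[N [mN N0 sN]].
have NT : N = setT.
  apply/seteqP; split => // y _; apply: sN => /= /(_ Logic.I)[] sxy.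
  by have := s0 (x, y); rewrite sxy ltxx.
have := @prob_kernel _ _ _ _ _ k x.
by rewrite -NT N0 => /esym/eqP; rewrite onee_eq0.
Qed.

Lemma measurable_kernel_mean : measurable_fun [set: X] kernel_mean.
Proof.
apply/measurable_EFinP.
rewrite (_ : _ \o _ = (fun x => \int[k x]_y (EFin \o s) (x, y))); last first.
  by apply/funext => x /=; rewrite kernel_meanE.
apply: measurable_fun_integral_finite_kernel.
  by move=> xy; rewrite lee_fin ltW.
exact/measurable_EFinP.
Qed.

Let density xy : R := (s xy / kernel_mean xy.1)%R.

Let density_gt0 xy : (0 < density xy)%R.
Proof. by rewrite divr_gt0// kernel_mean_gt0. Qed.

Let measurable_density : measurable_fun [set: X * Y] density.
Proof.
(* The quotient of positive functions, as the exponential of a difference. *)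
rewrite (_ : density = (fun xy => expR (ln (s xy) - ln (kernel_mean xy.1)))).
  apply: measurableT_comp => //; apply: measurable_funB.
    exact: measurableT_comp.
  apply: measurableT_comp => //; apply: measurableT_comp => //.
  exact: measurable_kernel_mean.
apply/funext => xy.
by rewrite expRD expRN !lnK// posrE// kernel_mean_gt0.
Qed.

(** The optimal transitions, the optimal policies and the component policies
    are all obtained by reweighting a baseline kernel in this way.  The density
    is jointly measurable by construction, hence the absolute continuity as
    kernels. *)
Lemma tilted_kernel : exists2 k' : R.-pker X ~> Y,
  (forall x A, measurable A ->
     k' x A = \int[k x]_(y in A) (s (x, y) / kernel_mean x)%:E) &
  kernel_ac k' k.
Proof.
have h1 x : \int[k x]_y (density (x, y))%:E = 1.
  rewrite /density/=; under eq_integral do rewrite EFinM.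
  have Z0 := kernel_mean_gt0 x.
  rewrite ge0_integralZr ?lee_fin ?invr_ge0 ?(ltW Z0)//; last first.
    by move=> y _; rewrite lee_fin ltW.
  by rewrite -kernel_meanE -EFinM mulfV// gt_eqF.
pose k' := density_pker measurable_density (fun xy => ltW (density_gt0 xy)) h1.
have muE x A : measurable A ->
  condlaw k' x A = \int[condlaw k x]_(y in A) (density (x, y))%:E by [].
exists k' => //; split.
  move=> x; apply: density_dominates (muE x).
  exact: measurableT_comp.
exists (EFin \o density); first exact/measurable_EFinP.
move=> x; have := density_Radon_Nikodym _ (muE x).
move=> /(_ (measurableT_comp measurable_density (pair1_measurable _))).
by apply: filterS => y /(_ Logic.I).
Qed.

End kernel_mean.

(** * Costs along a trajectory *)

Section kl_kernel.
Context dX dY (X : measurableType dX) (Y : measurableType dY) (R : realType).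

Lemma integral_condlaw (k : R.-pker X ~> Y) x (f : Y -> \bar R) :
  \int[condlaw k x]_y f y = \int[k x]_y f y.
Proof. exact: eq_measure_integral. Qed.

(** For each [x] the divergence is the integral of [lne (f (x, y))], where [f]
    is the jointly measurable version of the likelihood ratio; its positive and
    negative parts have measurable integrals against a kernel. *)
Lemma measurable_kl_kernel (k h : R.-pker X ~> Y) : kernel_ac k h ->
  measurable_fun [set: X] (fun x => kl (condlaw k x) (condlaw h x)).
Proof.
move=> [kh [f mf fE]].
have mlf : measurable_fun [set: X * Y] (@lne R \o f).
  by apply: measurableT_comp => //; exact: measurable_lne.
have -> : (fun x => kl (condlaw k x) (condlaw h x)) =
    (fun x => \int[k x]_y (@lne R \o f)^\+ (x, y) -
              \int[k x]_y (@lne R \o f)^\- (x, y)).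
  apply/funext => x.
  rewrite (@kl_ae_eq _ _ _ _ _ (fun y => f (x, y)) (kh x)).
  - rewrite integral_condlaw integralE.
    by congr (_ - _); apply: eq_integral => y _; rewrite ?funeposE ?funenegE.
  - exact: measurableT_comp.
  - by apply: filterS (fE x).
apply: emeasurable_funB; apply: measurable_fun_integral_finite_kernel => //.
- exact: measurable_funepos.
- exact: measurable_funeneg.
Qed.

End kl_kernel.

Section trajectory_integral.
Context dX dU (X : measurableType dX) (U : measurableType dU) (R : realType).
Variables (cT : X -> R) (stage : nat -> X * U -> \bar R).
Variables (pi : nat -> R.-pker X ~> U) (tau : nat -> R.-pker X * U ~> X).
Hypotheses (mcT : measurable_fun [set: X] cT) (cT0 : forall x, (0 <= cT x)%R).

Definition total_cost n t (xi : n.-tuple (X * U) * X) : \bar R :=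
  (cT xi.2)%:E + \sum_(k < n) stage (t + k)%N (tnth xi.1 k).

Definition expected_cost n t x : \bar R :=
  \int[traj_law pi tau n t x]_xi total_cost t xi.

(* The stage costs are only controlled in the range of times that the
   trajectory visits. *)
Let good t n := forall k, (t <= k < t + n)%N ->
  measurable_fun [set: X * U] (stage k) /\ forall xu, 0 <= stage k xu.

Let good_tail t n : good t n.+1 -> good t.+1 n.
Proof.
by move=> g k /andP[tk kn]; apply: g; rewrite (ltnW tk)/= addnS -addSn.
Qed.

Lemma total_cost_ge0 t n xi : good t n -> 0 <= @total_cost n t xi.
Proof.
move=> g; rewrite adde_ge0 ?lee_fin//; apply: sume_ge0 => k _.
by apply: (g _ _).2; rewrite leq_addr/= ltn_add2l.
Qed.

Lemma measurable_total_cost t n : good t n ->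
  measurable_fun [set: n.-tuple (X * U) * X] (@total_cost n t).
Proof.
move=> g; apply: emeasurable_funD.
  by apply/measurable_EFinP; apply: measurableT_comp.
apply: emeasurable_sum => k; apply: measurableT_comp.
  by apply: (g _ _).1; rewrite leq_addr/= ltn_add2l.
apply: (measurableT_comp (measurable_tnth k)); exact: measurable_fst.
Qed.

Lemma total_cost_cons t n (v : X * U * X * (n.-tuple (X * U) * X)) :
  total_cost t (traj_cons v) = stage t v.1.1 + total_cost t.+1 v.2.
Proof.
rewrite /total_cost /= big_ord_recl tnth0 addn0 addeCA; congr (_ + (_ + _)).
by apply: eq_bigr => k _; rewrite tnthS /= /bump/= add1n addnS addSn.
Qed.

Lemma measurable_expected_cost t n : good t n ->
  measurable_fun [set: X] (expected_cost n t).
Proof.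
move=> g; apply: measurable_fun_integral_kernel.
- by move=> A mA; exact: measurable_kernel.
- by move=> xi; exact: total_cost_ge0.
- exact: measurable_total_cost.
Qed.

Lemma expected_cost_ge0 t n x : good t n -> 0 <= expected_cost n t x.
Proof. by move=> g; apply: integral_ge0 => xi _; exact: total_cost_ge0. Qed.

Lemma expected_cost0 t x : expected_cost 0 t x = (cT x)%:E.
Proof.
have g0 : good t 0 by move=> k; rewrite addn0 leqNgt andNb.
rewrite /expected_cost /= integral_dirac//; last exact: measurable_total_cost.
by rewrite diracT mul1e /total_cost big_ord0 adde0.
Qed.

(** The dynamic programming recursion for a fixed policy: the law of a
    trajectory is an iterated composition of kernels, and the cost of the first
    stage is constant with respect to the draws that come after it. *)
Lemma expected_costS t n x : good t n.+1 ->
  expected_cost n.+1 t x =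
  \int[pi t x]_u (stage t (x, u) + \int[tau t (x, u)]_y expected_cost n t.+1 y).
Proof.
move=> g; have g' := good_tail g.
have [ms s0] := g t ltac:(by rewrite leqnn addnS ltnS leq_addr).
have mtot := measurable_total_cost g.
have tot0 xi := total_cost_ge0 xi g.
rewrite /expected_cost [LHS]integral_kcomp//.
apply: eq_integral => u _; rewrite [LHS]integral_kcomp//.
transitivity (\int[tau t (x, u)]_y (stage t (x, u) + expected_cost n t.+1 y)).
  apply: eq_integral => y _; rewrite [LHS]integral_kcomp//.
  transitivity (\int[traj_law pi tau n t.+1 y]_xi
      (stage t (x, u) + total_cost t.+1 xi)).
    apply: eq_integral => xi _; rewrite integral_dirac// diracT mul1e.
    exact: total_cost_cons.
  rewrite ge0_integralD//.
  - congr (_ + _).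
    exact: (integral_prob_cst (condlaw (traj_law pi tau n t.+1) y)).
  - by move=> xi _; exact: total_cost_ge0.
  - exact: measurable_total_cost.
rewrite ge0_integralD//.
- by congr (_ + _); exact: (integral_prob_cst (condlaw (tau t) (x, u))).
- by move=> y _; exact: expected_cost_ge0.
- exact: measurable_expected_cost.
Qed.

End trajectory_integral.

(** * The soft minimum at inverse temperature lambda *)

Section soft_minimum.
Context d (Y : measurableType d) (R : realType).
Variables (lambda : R) (nu : probability Y R) (F : Y -> R) (Z : R).
Hypotheses (lambda0 : (0 < lambda)%R).
Hypotheses (mF : measurable_fun [set: Y] F) (F0 : forall y, (0 <= F y)%R).
Hypotheses (Z0 : (0 < Z)%R).

Let mE : measurable_fun [set: Y] (fun y => lambda * F y)%R.
Proof. exact: measurable_funM. Qed.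

Let E0 y : (0 <= lambda * F y)%R.
Proof. by rewrite mulr_ge0// ltW. Qed.

(* Multiplying by [lambda] reduces to the variational principle for the energy
   [lambda * F]; distributivity holds in the extended reals because both terms
   are nonnegative. *)
Let rescale (mu : probability Y R) : mu `<< nu ->
  \int[mu]_y (F y)%:E + lambda^-1%:E * kl mu nu =
  lambda^-1%:E * (\int[mu]_y (lambda * F y)%:E + kl mu nu).
Proof.
move=> munu; have iF0 : 0 <= \int[mu]_y (F y)%:E.
  by apply: integral_ge0 => y _; rewrite lee_fin.
under [in RHS]eq_integral do rewrite EFinM.
rewrite ge0_integralZl_EFin ?(ltW lambda0)//; last 2 first.
- by move=> y _; rewrite lee_fin.
- exact/measurable_EFinP.
rewrite [RHS]ge0_muleDr ?kl_ge0 ?mule_ge0 ?lee_fin ?(ltW lambda0)//.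
by rewrite muleA -EFinM mulVf ?gt_eqF// mul1e.
Qed.

Lemma soft_minimum_le (mu : probability Y R) : mu `<< nu ->
  \int[nu]_y (expR (- (lambda * F y)))%:E = Z%:E ->
  (- (lambda^-1 * ln Z))%:E <= \int[mu]_y (F y)%:E + lambda^-1%:E * kl mu nu.
Proof.
move=> munu FZ; have [+ _] := gibbs_variational munu mE E0 Z0 FZ.
rewrite rescale// -mulrN EFinM => le; apply: lee_wpmul2l => //.
by rewrite lee_fin invr_ge0 ltW.
Qed.

Lemma soft_minimum_unique (mu : probability Y R) : mu `<< nu ->
  \int[nu]_y (expR (- (lambda * F y)))%:E = Z%:E ->
  \int[mu]_y (F y)%:E + lambda^-1%:E * kl mu nu = (- (lambda^-1 * ln Z))%:E ->
  forall A, measurable A ->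
    mu A = \int[nu]_(y in A) (expR (- (lambda * F y)) / Z)%:E.
Proof.
move=> munu FZ; have [_ +] := gibbs_variational munu mE E0 Z0 FZ.
rewrite rescale// -mulrN EFinM => uniq eqZ; apply: uniq.
have := congr1 (fun e => lambda%:E * e) eqZ.
by rewrite !muleA -!EFinM mulfV ?gt_eqF// mul1e mul1r.
Qed.

Lemma soft_minimum_attained (mu : probability Y R) :
  (forall A, measurable A ->
    mu A = \int[nu]_(y in A) (expR (- (lambda * F y)) / Z)%:E) ->
  \int[mu]_y (F y)%:E + lambda^-1%:E * kl mu nu = (- (lambda^-1 * ln Z))%:E.
Proof.
move=> muE; have munu : mu `<< nu.
  apply: density_dominates muE.
  apply: measurable_funM => //; apply: measurableT_comp => //.
  exact: measurableT_comp.
by rewrite rescale// (gibbs_attained mE E0 Z0 muE) -EFinM mulrN.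
Qed.

End soft_minimum.

(** * The linear backup of desirabilities *)

(** Desirabilities are exponentials of nonpositive quantities; the upper bound 1
    is the nonnegativity of the costs, and it makes all the means finite. *)
Definition is_desirability (d : measure_display) (X : measurableType d)
    (R : realType) (s : X -> R) :=
  measurable_fun [set: X] s /\ forall x, (0 < s x <= 1)%R.

Section desirability_backup.
Context dX dU (X : measurableType dX) (U : measurableType dU) (R : realType).
Variables (lambda : R) (rho : R.-pker X ~> U) (iota : R.-pker X * U ~> X).
Variables (c : X * U -> R).

(** This is [r_t E_iota s], the exponential of [- lambda Q_t] when [s] is the
    desirability at the next time. *)
Definition action_backup (s : X -> R) (xu : X * U) : R :=
  (expR (- (lambda * c xu)) * kernel_mean iota (fun p => s p.2) xu)%R.

Definition backup (s : X -> R) (x : X) : R :=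
  kernel_mean rho (action_backup s) x.

Hypotheses (lambda0 : (0 < lambda)%R) (mc : measurable_fun [set: X * U] c)
  (c0 : forall xu, (0 <= c xu)%R).

Section one_desirability.
Variable s : X -> R.
Hypothesis s_des : is_desirability s.

Let ms2 : measurable_fun [set: X * U * X] (fun p : X * U * X => s p.2).
Proof. by apply: measurableT_comp; [exact: s_des.1|exact: measurable_snd]. Qed.

Let s2_gt0 (p : X * U * X) : (0 < s p.2)%R.
Proof. by have /andP[] := s_des.2 p.2. Qed.

Let s2_le1 (p : X * U * X) : (s p.2 <= 1)%R.
Proof. by have /andP[] := s_des.2 p.2. Qed.

Lemma action_backup_gt0 xu : (0 < action_backup s xu)%R.
Proof.
rewrite mulr_gt0 ?expR_gt0//.
exact: (kernel_mean_gt0 iota ms2 s2_gt0 s2_le1).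
Qed.

Lemma action_backup_le1 xu : (action_backup s xu <= 1)%R.
Proof.
rewrite mulr_ile1 ?expR_ge0//.
- exact/ltW/(kernel_mean_gt0 iota ms2 s2_gt0 s2_le1).
- by rewrite expR_le1 oppr_le0 mulr_ge0// ltW.
- exact: (kernel_mean_le iota ms2 s2_gt0 s2_le1).
Qed.

Lemma measurable_action_backup : measurable_fun [set: X * U] (action_backup s).
Proof.
apply: measurable_funM.
  apply: measurableT_comp => //; apply: measurableT_comp => //.
  exact: measurable_funM.
exact: (measurable_kernel_mean iota ms2 s2_gt0 s2_le1).
Qed.

Lemma action_backupE xu : (action_backup s xu)%:E =
  (expR (- (lambda * c xu)))%:E * \int[iota xu]_y (s y)%:E.
Proof. by rewrite EFinM (kernel_meanE iota ms2 s2_gt0 s2_le1). Qed.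

Lemma backupE x : (backup s x)%:E = \int[rho x]_u (action_backup s (x, u))%:E.
Proof.
exact: (kernel_meanE rho measurable_action_backup action_backup_gt0
  action_backup_le1).
Qed.

Lemma is_desirability_backup : is_desirability (backup s).
Proof.
split; first exact: (measurable_kernel_mean rho measurable_action_backup
  action_backup_gt0 action_backup_le1).
move=> x; apply/andP; split.
  exact: (kernel_mean_gt0 rho measurable_action_backup action_backup_gt0
    action_backup_le1).
exact: (kernel_mean_le rho measurable_action_backup action_backup_gt0
  action_backup_le1).
Qed.

Lemma backup_tilted_kernel : exists2 pi : R.-pker X ~> U,
  (forall x A, measurable A -> pi x A =
     \int[rho x]_(u in A) (action_backup s (x, u) / backup s x)%:E) &
  kernel_ac pi rho.
Proof.
exact: (tilted_kernel rho measurable_action_backup action_backup_gt0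
  action_backup_le1).
Qed.

Lemma transition_tilted_kernel : exists2 tau : R.-pker X * U ~> X,
  (forall xu A, measurable A -> tau xu A =
     \int[iota xu]_(y in A) (s y / kernel_mean iota (fun p => s p.2) xu)%:E) &
  kernel_ac tau iota.
Proof. exact: (tilted_kernel iota ms2 s2_gt0 s2_le1). Qed.

End one_desirability.

Section sum_of_desirabilities.
Variables (N : nat) (s : 'I_N -> X -> R).
Hypothesis s_des : forall n, is_desirability (s n).

Lemma action_backup_sum xu :
  action_backup (fun x => \sum_(n < N) s n x)%R xu =
  (\sum_(n < N) action_backup (s n) xu)%R.
Proof.
rewrite -mulr_sumr; congr (_ * _)%R; rewrite /kernel_mean /=.
under eq_integral do rewrite -sumEFin.
rewrite ge0_integral_sum//; last 2 first.
- by move=> n; apply/measurable_EFinP; exact: (s_des n).1.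
- by move=> n y _; rewrite lee_fin ltW//; have /andP[] := (s_des n).2 y.
rewrite (eq_bigr (fun n => (kernel_mean iota (fun p => s n p.2) xu)%:E)).
  by rewrite sumEFin.
move=> n _.
have sn_gt0 (p : X * U * X) : (0 < s n p.2)%R.
  by have /andP[] := (s_des n).2 p.2.
have sn_le1 (p : X * U * X) : (s n p.2 <= 1)%R.
  by have /andP[] := (s_des n).2 p.2.
rewrite -(kernel_meanE iota _ sn_gt0 sn_le1)//.
by apply: measurableT_comp; [exact: (s_des n).1|exact: measurable_snd].
Qed.

Lemma backup_sum x : backup (fun x => \sum_(n < N) s n x)%R x =
  (\sum_(n < N) backup (s n) x)%R.
Proof.
rewrite {1}/backup /kernel_mean.
under eq_integral do rewrite action_backup_sum -sumEFin.
rewrite ge0_integral_sum//; last 2 first.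
- move=> n; apply/measurable_EFinP; apply: measurableT_comp => //.
  exact: measurable_action_backup.
- by move=> n u _; rewrite lee_fin ltW// action_backup_gt0.
rewrite (eq_bigr (fun n => (backup (s n) x)%:E)) ?sumEFin// => n _.
by rewrite backupE.
Qed.

End sum_of_desirabilities.
End desirability_backup.

(** * Solution of the control problem *)

(** A function [zeta] that satisfies the linear recursion is given, and the
    control problem is solved in terms of it: [- lambda^-1 * ln zeta] is the
    value function, and tilting by [zeta] gives the minimisers.  The sum of the
    component desirabilities is eventually taken for [zeta]. *)
Section linearly_solvable.
Context dX dU (X : measurableType dX) (U : measurableType dU) (R : realType).
Variables (T : nat) (lambda : R).
Variables (rho : nat -> R.-pker X ~> U) (iota : nat -> R.-pker X * U ~> X).
Variables (c : nat -> X * U -> R) (cT : X -> R).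
Hypothesis lambda0 : (0 < lambda)%R.
Hypothesis mc : forall t, (t < T)%N -> measurable_fun [set: X * U] (c t).
Hypothesis c0 : forall t xu, (t < T)%N -> (0 <= c t xu)%R.
Hypothesis mcT : measurable_fun [set: X] cT.
Hypothesis cT0 : forall x, (0 <= cT x)%R.

Variable zeta : nat -> X -> R.
Hypothesis zeta_des : forall t, (t <= T)%N -> is_desirability (zeta t).
Hypothesis zetaT : forall x, zeta T x = expR (- (lambda * cT x)).

Definition action_desirability t : X * U -> R :=
  action_backup lambda (iota t) (c t) (zeta t.+1).

Hypothesis zetaS : forall t x, (t < T)%N ->
  zeta t x = backup lambda (rho t) (iota t) (c t) (zeta t.+1) x.

Let zeta_gt0 t x : (t <= T)%N -> (0 < zeta t x)%R.
Proof. by move=> /zeta_des[_ /(_ x)/andP[]]. Qed.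

Let zeta_le1 t x : (t <= T)%N -> (zeta t x <= 1)%R.
Proof. by move=> /zeta_des[_ /(_ x)/andP[]]. Qed.

Let mzeta t : (t <= T)%N -> measurable_fun [set: X] (zeta t).
Proof. by move=> /zeta_des[]. Qed.

Definition soft_value t x : R := (- (lambda^-1 * ln (zeta t x)))%R.
Definition soft_Q t xu : R := (- (lambda^-1 * ln (action_desirability t xu)))%R.

Lemma expR_soft (s : R) : (0 < s)%R ->
  expR (- (lambda * - (lambda^-1 * ln s))) = s.
Proof. by move=> s0; rewrite mulrN opprK mulrA mulfV ?gt_eqF// mul1r lnK. Qed.

Lemma soft_ge0 (s : R) : (s <= 1)%R -> (0 <= - (lambda^-1 * ln s))%R.
Proof.
move=> s1; rewrite oppr_ge0 mulr_ge0_le0 ?invr_ge0 ?(ltW lambda0)//.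
by rewrite ln_le0.
Qed.

Lemma measurable_soft d (Y : measurableType d) (s : Y -> R) :
  measurable_fun [set: Y] s ->
  measurable_fun [set: Y] (fun y => - (lambda^-1 * ln (s y)))%R.
Proof.
move=> ms; apply: measurableT_comp => //; apply: measurable_funM => //.
exact: measurableT_comp.
Qed.

Section stage.
Variable t : nat.
Hypothesis tT : (t < T)%N.

Let next_des : is_desirability (zeta t.+1) := zeta_des tT.

Lemma action_desirability_gt0 xu : (0 < action_desirability t xu)%R.
Proof. exact: action_backup_gt0. Qed.

Lemma action_desirability_le1 xu : (action_desirability t xu <= 1)%R.
Proof. by apply: action_backup_le1 => // ?; exact: c0. Qed.

Lemma measurable_action_desirability :
  measurable_fun [set: X * U] (action_desirability t).
Proof. by apply: measurable_action_backup => //; exact: mc. Qed.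

(** The energy that is minimised over the law of the next state. *)
Definition one_step x u (y : X) : R := (c t (x, u) + soft_value t.+1 y)%R.

Lemma measurable_one_step x u : measurable_fun [set: X] (one_step x u).
Proof.
by apply: measurable_funD => //; apply: measurable_soft; exact: mzeta.
Qed.

Lemma one_step_ge0 x u y : (0 <= one_step x u y)%R.
Proof. by rewrite addr_ge0 ?c0// soft_ge0// zeta_le1. Qed.

Lemma expR_one_step x u y : expR (- (lambda * one_step x u y)) =
  (expR (- (lambda * c t (x, u))) * zeta t.+1 y)%R.
Proof. by rewrite mulrDr opprD expRD expR_soft// zeta_gt0. Qed.

Lemma integral_one_step x u :
  \int[condlaw (iota t) (x, u)]_y (expR (- (lambda * one_step x u y)))%:E =
  (action_desirability t (x, u))%:E.
Proof.
under eq_integral do rewrite expR_one_step EFinM.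
rewrite ge0_integralZl_EFin ?expR_ge0//; last 2 first.
- by move=> y _; rewrite lee_fin ltW// zeta_gt0.
- by apply/measurable_EFinP; exact: mzeta.
by rewrite integral_condlaw -action_backupE.
Qed.

(** The factor [exp (- lambda c_t)] does not depend on the next state and
    cancels in the Gibbs density. *)
Lemma tilted_transition : exists2 tau : R.-pker X * U ~> X,
  (forall x u A, measurable A -> condlaw tau (x, u) A =
     \int[condlaw (iota t) (x, u)]_(y in A)
       (expR (- (lambda * one_step x u y)) / action_desirability t (x, u))%:E) &
  kernel_ac tau (iota t).
Proof.
have [tau tauE tau_ac] := transition_tilted_kernel (iota t) next_des.
exists tau => // x u A mA; rewrite [LHS]tauE//.
apply: eq_integral => y _; rewrite expR_one_step /action_desirability.
by rewrite -mulf_div divff ?mul1r// gt_eqF// expR_gt0.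
Qed.

Lemma integral_soft_Q x :
  \int[condlaw (rho t) x]_u (expR (- (lambda * soft_Q t (x, u))))%:E =
  (zeta t x)%:E.
Proof.
rewrite integral_condlaw zetaS// backupE//; [|exact: mc|by move=> ?; exact: c0].
by apply: eq_integral => u _; rewrite expR_soft// action_desirability_gt0.
Qed.

Lemma tilted_policy : exists2 pi : R.-pker X ~> U,
  (forall x A, measurable A -> condlaw pi x A =
     \int[condlaw (rho t) x]_(u in A)
       (expR (- (lambda * soft_Q t (x, u))) / zeta t x)%:E) &
  kernel_ac pi (rho t).
Proof.
have [pi piE pi_ac] := backup_tilted_kernel (rho t) (iota t) lambda0 (mc tT)
  (fun xu => c0 xu tT) next_des.
exists pi => // x A mA; rewrite [LHS]piE//.
apply: eq_integral => u _.
by rewrite expR_soft ?zetaS// action_desirability_gt0.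
Qed.

Lemma measurable_soft_Q : measurable_fun [set: X * U] (soft_Q t).
Proof. by apply: measurable_soft; exact: measurable_action_desirability. Qed.

Lemma soft_Q_ge0 xu : (0 <= soft_Q t xu)%R.
Proof. by rewrite soft_ge0// action_desirability_le1. Qed.

End stage.

Lemma soft_value_ge0 t x : (t <= T)%N -> (0 <= soft_value t x)%R.
Proof. by move=> tT; rewrite soft_ge0// zeta_le1. Qed.

Lemma measurable_soft_value t : (t <= T)%N ->
  measurable_fun [set: X] (soft_value t).
Proof. by move=> tT; apply: measurable_soft; exact: mzeta. Qed.

Lemma soft_Q_le t x u (nu : probability X R) : (t < T)%N ->
  nu `<< condlaw (iota t) (x, u) ->
  (soft_Q t (x, u))%:E <= \int[nu]_y (one_step t x u y)%:E +
    lambda^-1%:E * kl nu (condlaw (iota t) (x, u)).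
Proof.
move=> tT nui; apply: (soft_minimum_le lambda0 _ _ _ nui).
- exact: measurable_one_step.
- exact: one_step_ge0.
- exact: action_desirability_gt0.
- exact: integral_one_step.
Qed.

Lemma soft_value_le t x (nu : probability U R) : (t < T)%N ->
  nu `<< condlaw (rho t) x ->
  (soft_value t x)%:E <= \int[nu]_u (soft_Q t (x, u))%:E +
    lambda^-1%:E * kl nu (condlaw (rho t) x).
Proof.
move=> tT nui; apply: (soft_minimum_le lambda0 _ _ _ nui).
- by apply: measurableT_comp; first exact: measurable_soft_Q.
- by move=> u; exact: soft_Q_ge0.
- by apply: zeta_gt0; exact: ltnW.
- exact: integral_soft_Q.
Qed.

Definition attains_soft_Q t (tau : R.-pker X * U ~> X) :=
  kernel_ac tau (iota t) /\ forall x u,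
  \int[condlaw tau (x, u)]_y (one_step t x u y)%:E +
    lambda^-1%:E * kl (condlaw tau (x, u)) (condlaw (iota t) (x, u)) =
  (soft_Q t (x, u))%:E.

Lemma soft_transition_ex t : (t < T)%N ->
  exists tau, attains_soft_Q t tau.
Proof.
move=> tT; have [tau tauE tau_ac] := tilted_transition tT.
exists tau; split => // x u.
apply: (soft_minimum_attained lambda0 _ _ _ (tauE x u)).
- exact: measurable_one_step.
- exact: one_step_ge0.
- exact: action_desirability_gt0.
Qed.

Definition attains_soft_value t (pi : R.-pker X ~> U) :=
  kernel_ac pi (rho t) /\ forall x,
  \int[condlaw pi x]_u (soft_Q t (x, u))%:E +
    lambda^-1%:E * kl (condlaw pi x) (condlaw (rho t) x) =
  (soft_value t x)%:E.

Lemma soft_policy_ex t : (t < T)%N -> exists2 pi : R.-pker X ~> U,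
  (forall x A, measurable A -> pi x A =
     \int[rho t x]_(u in A) (action_desirability t (x, u) / zeta t x)%:E) &
  attains_soft_value t pi.
Proof.
move=> tT; have [pi piE pi_ac] := tilted_policy tT; exists pi.
  move=> x A mA; rewrite [LHS]piE//; apply: eq_integral => u _.
  by rewrite expR_soft// action_desirability_gt0.
split => // x; apply: (soft_minimum_attained lambda0 _ _ _ (piE x)).
- by apply: measurableT_comp; first exact: measurable_soft_Q.
- by move=> u; exact: soft_Q_ge0.
- by apply: zeta_gt0; exact: ltnW.
Qed.

Section bellman.
Variables (pi : nat -> R.-pker X ~> U) (tau : nat -> R.-pker X * U ~> X).

(** The divergences are part of the cost of the stage, so that the objective is
    the [expected_cost] of this stage cost. *)
Definition stage_cost t (xu : X * U) : \bar R :=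
  (c t xu)%:E
  + lambda^-1%:E * kl (condlaw (pi t) xu.1) (condlaw (rho t) xu.1)
  + lambda^-1%:E * kl (condlaw (tau t) xu) (condlaw (iota t) xu).

Let scaled_kl_ge0 d (Y : measurableType d) (mu nu : probability Y R) :
  mu `<< nu -> 0 <= lambda^-1%:E * kl mu nu.
Proof. by move=> munu; rewrite mule_ge0 ?kl_ge0// lee_fin invr_ge0 ltW. Qed.

Lemma stage_cost_regular t : (t < T)%N ->
  kernel_ac (pi t) (rho t) -> kernel_ac (tau t) (iota t) ->
  measurable_fun [set: X * U] (stage_cost t) /\ forall xu, 0 <= stage_cost t xu.
Proof.
move=> tT piac tauac; split.
  apply: emeasurable_funD; last first.
    by apply: measurable_funeM; exact: measurable_kl_kernel.
  apply: emeasurable_funD; first by apply/measurable_EFinP; exact: mc.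
  apply: measurable_funeM.
  apply: (measurableT_comp (measurable_kl_kernel piac)).
  exact: measurable_fst.
move=> xu; rewrite !adde_ge0 ?lee_fin ?c0//; apply: scaled_kl_ge0.
  exact: piac.1.
exact: tauac.1.
Qed.

Section one_stage.
Variables (t : nat) (tT : (t < T)%N).
Hypotheses (piac : kernel_ac (pi t) (rho t))
  (tauac : kernel_ac (tau t) (iota t)).

Let V y := (soft_value t.+1 y)%:E.

Let V0 y : 0 <= V y. Proof. by rewrite lee_fin soft_value_ge0. Qed.

Let mV : measurable_fun [set: X] V.
Proof. by apply/measurable_EFinP; exact: measurable_soft_value. Qed.

Let klpi x := lambda^-1%:E * kl (condlaw (pi t) x) (condlaw (rho t) x).
Let kltau x u := lambda^-1%:E *
  kl (condlaw (tau t) (x, u)) (condlaw (iota t) (x, u)).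

(** This regrouping shows the two nested minimisations: the bracket is minimised
    by the transition, and its minimum is the energy of the policy. *)
Lemma stage_cost_next x u :
  stage_cost t (x, u) + \int[tau t (x, u)]_y V y =
  (\int[condlaw (tau t) (x, u)]_y (one_step t x u y)%:E + kltau x u) + klpi x.
Proof.
have -> : \int[condlaw (tau t) (x, u)]_y (one_step t x u y)%:E =
    (c t (x, u))%:E + \int[tau t (x, u)]_y V y.
  transitivity (\int[condlaw (tau t) (x, u)]_y ((c t (x, u))%:E + V y)) => //.
  rewrite ge0_integralD//; last by move=> y _; rewrite lee_fin c0.
  by rewrite integral_prob_cst integral_condlaw.
rewrite /stage_cost -/(klpi x) -/(kltau x u).
by rewrite [LHS]addeAC [X in X + _ = _]addeAC [LHS]addeAC.
Qed.

(** The cost-to-go [W] of an arbitrary continuation is allowed, which is what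
    the backward induction on the trajectory cost needs. *)
Lemma bellman_le x (W : X -> \bar R) : measurable_fun [set: X] W ->
  (forall y, V y <= W y) ->
  (soft_value t x)%:E <=
  \int[pi t x]_u (stage_cost t (x, u) + \int[tau t (x, u)]_y W y).
Proof.
move=> mW VW; have W0 y : 0 <= W y by exact: le_trans (VW y).
have [ms s0] := stage_cost_regular tT piac tauac.
apply: le_trans (soft_value_le tT (piac.1 x)) _.
rewrite -/(klpi x) integral_condlaw.
rewrite -[klpi x](integral_prob_cst (condlaw (pi t) x)).
rewrite [X in _ + X]integral_condlaw -ge0_integralD//; last 3 first.
- by move=> u _; rewrite lee_fin soft_Q_ge0.
- apply/measurable_EFinP; apply: measurableT_comp => //.
  exact: measurable_soft_Q.
- by move=> u _; apply: scaled_kl_ge0; exact: piac.1.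
apply: ge0_le_integral => //.
- move=> u _; rewrite adde_ge0 ?lee_fin ?soft_Q_ge0//.
  by apply: scaled_kl_ge0; exact: piac.1.
- apply: emeasurable_funD => //; apply/measurable_EFinP.
  by apply: measurableT_comp => //; exact: measurable_soft_Q.
- apply: (@measurableT_comp _ _ _ _ _ _
    (fun xu => stage_cost t xu + \int[tau t xu]_y W y)) => //.
  apply: emeasurable_funD => //; apply: measurable_fun_integral_kernel => //.
  by move=> A mA; exact: measurable_kernel.
move=> u _.
apply: (@le_trans _ _ (stage_cost t (x, u) + \int[tau t (x, u)]_y V y)).
  rewrite stage_cost_next leeD2r//.
  by apply: soft_Q_le => //; exact: tauac.1.
by apply: leeD2l => //; apply: ge0_le_integral.
Qed.

Lemma bellman_eq x : attains_soft_value t (pi t) ->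
  attains_soft_Q t (tau t) ->
  \int[pi t x]_u (stage_cost t (x, u) + \int[tau t (x, u)]_y V y) =
  (soft_value t x)%:E.
Proof.
move=> [_ pi_opt] [_ tau_opt].
under eq_integral do rewrite stage_cost_next tau_opt.
rewrite ge0_integralD//; last 3 first.
- by move=> u _; rewrite lee_fin soft_Q_ge0.
- apply/measurable_EFinP; apply: measurableT_comp => //.
  exact: measurable_soft_Q.
- by move=> u _; apply: scaled_kl_ge0; exact: piac.1.
rewrite -!(integral_condlaw (pi t)) integral_prob_cst.
exact: pi_opt.
Qed.

End one_stage.
End bellman.

Lemma soft_valueT x : soft_value T x = cT x.
Proof.
by rewrite /soft_value zetaT expRK mulrN opprK mulrA mulVf ?gt_eqF// mul1r.
Qed.

Section trajectory_cost.
Variables (pi : nat -> R.-pker X ~> U) (tau : nat -> R.-pker X * U ~> X).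

Let J n t x := expected_cost cT (stage_cost pi tau) pi tau n t x.

Let stage_regular n t : (t + n = T)%N -> admissible T rho iota t pi tau ->
  forall k, (t <= k < t + n)%N ->
  measurable_fun [set: X * U] (stage_cost pi tau k) /\
  forall xu, 0 <= stage_cost pi tau k xu.
Proof.
move=> tnT adm k; rewrite tnT => tkT; have /andP[_ kT] := tkT.
by have [piac tauac] := adm k tkT; exact: stage_cost_regular.
Qed.

Lemma soft_value_le_expected_cost n t x : (t + n = T)%N ->
  admissible T rho iota t pi tau -> (soft_value t x)%:E <= J n t x.
Proof.
elim: n t x => [t x|n IH t x tnT adm].
  by rewrite addn0 => -> _; rewrite /J expected_cost0// soft_valueT.
have tT : (t < T)%N by rewrite -tnT addnS ltnS leq_addr.
have adm' : admissible T rho iota t.+1 pi tau.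
  by move=> k /andP[tk kT]; apply: adm; rewrite ltnW.
have [piac tauac] := adm t ltac:(by rewrite leqnn).
have tnT' : (t.+1 + n = T)%N by rewrite addSn -addnS.
rewrite /J expected_costS//; last exact: stage_regular.
apply: bellman_le => //.
- by apply: measurable_expected_cost => //; exact: stage_regular.
- by move=> y; exact: IH.
Qed.

Lemma expected_cost_optimal n t x : (t + n = T)%N ->
  (forall k, (k < T)%N ->
    attains_soft_value k (pi k) /\ attains_soft_Q k (tau k)) ->
  J n t x = (soft_value t x)%:E.
Proof.
move=> + opt; have adm s : admissible T rho iota s pi tau.
  by move=> k /andP[_ /opt[[piac _] [tauac _]]].
elim: n t x => [t x|n IH t x tnT].
  by rewrite addn0 => ->; rewrite /J expected_cost0// soft_valueT.
have tT : (t < T)%N by rewrite -tnT addnS ltnS leq_addr.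
have [piopt tauopt] := opt t tT.
rewrite /J expected_costS//; last by apply: stage_regular.
rewrite -(bellman_eq tT piopt.1 x piopt tauopt).
apply: eq_integral => u _; congr (_ + _); apply: eq_integral => y _.
by apply: IH; rewrite addSn -addnS.
Qed.

End trajectory_cost.

(** The minimum over all the later policies and transitions at once is reached
    by choosing the stage minimisers for each time separately. *)
Lemma value_attained t x : (t <= T)%N ->
  value T lambda rho iota c cT t x = (soft_value t x)%:E /\
  objective_values T lambda rho iota c cT t x (soft_value t x)%:E.
Proof.
move=> tT.
have [k|pi piP] := choice
    (P := fun k (p : R.-pker X ~> U) => (k < T)%N -> attains_soft_value k p).
  have [kT|Tk] := ltnP k T; last by exists (rho k).
  by have [p _ popt] := soft_policy_ex kT; exists p.
have [k|tau tauP] := choice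
    (P := fun k (p : R.-pker X * U ~> X) => (k < T)%N -> attains_soft_Q k p).
  have [kT|Tk] := ltnP k T; last by exists (iota k).
  by have [p popt] := soft_transition_ex kT; exists p.
have ov : objective_values T lambda rho iota c cT t x (soft_value t x)%:E.
  exists pi, tau; split.
    by move=> k /andP[_ kT]; split; [exact: (piP k kT).1|exact: (tauP k kT).1].
  rewrite -(@expected_cost_optimal pi tau (T - t) t x)// ?subnKC// => k kT.
  by split; [exact: piP|exact: tauP].
split => //; apply/eqP; rewrite eq_le ereal_inf_lbound//=.
apply/ereal_infP => _ [pi' [tau' [adm ->]]].
by apply: (@soft_value_le_expected_cost pi' tau' (T - t)); rewrite ?subnKC.
Qed.

Lemma Q_attained t x u : (t < T)%N ->
  Qfun T lambda rho iota c cT t x u = (soft_Q t (x, u))%:E /\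
  Q_values T lambda rho iota c cT t x u (soft_Q t (x, u))%:E.
Proof.
move=> tT.
have JE (nu : probability X R) :
    \int[nu]_y ((c t (x, u))%:E + value T lambda rho iota c cT t.+1 y) =
    \int[nu]_y (one_step t x u y)%:E.
  by apply: eq_integral => y _; rewrite (value_attained _ tT).1.
have qv : Q_values T lambda rho iota c cT t x u (soft_Q t (x, u))%:E.
  have [tau [tauac tauopt]] := soft_transition_ex tT.
  exists (condlaw tau (x, u)); split; first exact: tauac.1.
  by rewrite JE tauopt.
split => //; apply/eqP; rewrite eq_le ereal_inf_lbound//=.
apply/ereal_infP => _ [nu [nui ->]].
by rewrite JE; exact: soft_Q_le.
Qed.

Lemma stage_objectiveE t x (nu : probability U R) : (t < T)%N ->
  stage_objective T lambda rho iota c cT t x nu =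
  \int[nu]_u (soft_Q t (x, u))%:E + lambda^-1%:E * kl nu (condlaw (rho t) x).
Proof.
move=> tT; congr (_ + _); apply: eq_integral => u _.
by rewrite (Q_attained _ _ tT).1.
Qed.

Lemma attains_soft_value_optimal t pi : (t < T)%N -> attains_soft_value t pi ->
  optimal_policy T lambda rho iota c cT t pi.
Proof.
move=> tT [piac piopt] x; split; first exact: piac.1.
by move=> nu nur; rewrite !stage_objectiveE// piopt; exact: soft_value_le.
Qed.

(** Any other minimiser of the stage objective reaches the soft minimum too, and
    the equality case of the variational principle determines it. *)
Lemma optimal_policy_unique t (pi : R.-pker X ~> U) : (t < T)%N ->
  optimal_policy T lambda rho iota c cT t pi ->
  forall x A, measurable A -> pi x A =
    \int[rho t x]_(u in A) (action_desirability t (x, u) / zeta t x)%:E.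
Proof.
move=> tT piopt x A mA; have [pir pimin] := piopt x.
have [pi' _ [pi'ac pi'opt]] := soft_policy_ex tT.
have min : \int[condlaw pi x]_u (soft_Q t (x, u))%:E +
    lambda^-1%:E * kl (condlaw pi x) (condlaw (rho t) x) = (soft_value t x)%:E.
  apply/eqP; rewrite eq_le soft_value_le// andbT -pi'opt.
  by rewrite -!stage_objectiveE//; apply: pimin; exact: pi'ac.1.
rewrite [LHS](soft_minimum_unique lambda0 _ _ _ pir _ min)//.
- by apply: eq_integral => u _; rewrite expR_soft// action_desirability_gt0.
- by apply: measurableT_comp; first exact: measurable_soft_Q.
- by move=> u; exact: soft_Q_ge0.
- by apply: zeta_gt0; exact: ltnW.
- exact: integral_soft_Q.
Qed.

Lemma desirability_soft t x : (t <= T)%N ->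
  desirability T lambda rho iota c cT t x = (zeta t x)%:E.
Proof.
move=> tT; rewrite /desirability (value_attained x tT).1 -EFinM -EFinN /=.
by rewrite expR_soft// zeta_gt0.
Qed.

End linearly_solvable.

(** * The decomposition *)

Theorem theorem2 (R : realType) (dX dU : measure_display)
    (X : measurableType dX) (U : measurableType dU)
    (T : nat) (lambda : R) (hlambda : (0 < lambda)%R)
    (rho : nat -> R.-pker X ~> U) (iota : nat -> R.-pker X * U ~> X)
    (c : nat -> X * U -> R) (cT : X -> R)
    (mc : forall t, (t < T)%N -> measurable_fun [set: X * U] (c t))
    (c_ge0 : forall t xu, (t < T)%N -> (0 <= c t xu)%R)
    (mcT : measurable_fun [set: X] cT)
    (cT_ge0 : forall x, (0 <= cT x)%R)
    (N : nat) (gamma : 'I_N -> R) (cTn : 'I_N -> X -> R)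
    (gamma_gt0 : forall n, (0 < gamma n)%R)
    (mcTn : forall n, measurable_fun [set: X] (cTn n))
    (decomp : forall x, (expR (- (lambda * cT x)) =
      \sum_(n < N) gamma n * expR (- (lambda * cTn n x)))%R)
    (zn : 'I_N -> nat -> X -> \bar R)
    (znT : forall n x, zn n T x = (gamma n * expR (- (lambda * cTn n x)))%:E)
    (znt : forall n t x, (t < T)%N -> zn n t x =
      \int[rho t x]_u (reward lambda c t x u * \int[iota t (x, u)]_y zn n t.+1 y)) :
  let z := desirability T lambda rho iota c cT in
  let w := fun n t x => zn n t x / z t x in
  (* the minima defining V_t and Q_t are attained *)
  (forall t x, (t <= T)%N ->
     objective_values T lambda rho iota c cT t x (value T lambda rho iota c cT t x)) /\
  (forall t x u, (t < T)%N ->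
     Q_values T lambda rho iota c cT t x u (Qfun T lambda rho iota c cT t x u)) /\
  forall t, (t < T)%N ->
    (forall x, z t x = \sum_(n < N) zn n t x) /\
    (forall x, \sum_(n < N) w n t x = 1) /\
    exists (pin : 'I_N -> R.-pker X ~> U) (pistar : R.-pker X ~> U),
      [/\ (* the component policies are rho_t r_t E_iota[z_{t+1}^n] / z_t^n *)
          forall n x A, measurable A -> pin n x A = \int[rho t x]_(u in A)
            (reward lambda c t x u * (\int[iota t (x, u)]_y zn n t.+1 y)
             / zn n t x),
          optimal_policy T lambda rho iota c cT t pistar,
          (forall pi : R.-pker X ~> U,
             optimal_policy T lambda rho iota c cT t pi ->
             forall x A, measurable A -> pi x A = pistar x A) &
          forall x A, measurable A ->
            pistar x A = \sum_(n < N) w n t x * pin n x A].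

Proof.
pose za n t x := fine (zn n t x).
pose zeta t x := (\sum_(n < N) za n t x)%R.
(* Each component desirability is at most 1, being a term of a sum of positive
   terms that is at most 1 at time [T], and the backup preserves the bound. *)
have expT_le1 x : (expR (- (lambda * cT x)) <= 1)%R.
  by rewrite expR_le1 oppr_le0 mulr_ge0// ltW.
have zaT n : is_desirability (za n T).
  have zaTE x : za n T x = (gamma n * expR (- (lambda * cTn n x)))%R.
    by rewrite /za znT.
  split.
    rewrite (funext zaTE); apply: measurable_funM => //.
    apply: measurableT_comp => //; apply: measurableT_comp => //.
    exact: measurable_funM.
  move=> x; rewrite zaTE mulr_gt0 ?expR_gt0//=.
  apply: le_trans (expT_le1 x); rewrite decomp (bigD1 n)//= lerDl.
  by apply: sumr_ge0 => i _; rewrite mulr_ge0 ?expR_ge0 ?ltW.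
have zaP k t : (t + k = T)%N -> forall n, is_desirability (za n t) /\
    (forall x, zn n t x = (za n t x)%:E) /\
    ((t < T)%N -> za n t =1 backup lambda (rho t) (iota t) (c t) (za n t.+1)).
  elim: k t => [t|k IH t tkT n].
    rewrite addn0 => -> n; rewrite ltnn; split => //; split => // x.
    by rewrite /za znT.
  have tT : (t < T)%N by rewrite -tkT addnS ltnS leq_addr.
  have [des [znE _]] := IH t.+1 ltac:(by rewrite addSn -addnS) n.
  have back x :
      zn n t x = (backup lambda (rho t) (iota t) (c t) (za n t.+1) x)%:E.
    rewrite znt// backupE//; [|exact: mc|by move=> ?; exact: c_ge0].
    apply: eq_integral => u _; rewrite action_backupE//; congr (_ * _).
    by apply: eq_integral => y _; rewrite znE.
  have zaE : za n t = backup lambda (rho t) (iota t) (c t) (za n t.+1).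
    by apply/funext => x; rewrite /za back.
  split; last by split => [x|_ x]; rewrite ?back zaE.
  rewrite zaE.
  by apply: is_desirability_backup => // ?; [exact: mc|exact: c_ge0].
have za_des n t : (t <= T)%N -> is_desirability (za n t).
  by move=> tT; have [] := zaP (T - t)%N t (subnKC tT) n.
have znE n t x : (t <= T)%N -> zn n t x = (za n t x)%:E.
  by move=> tT; have [_ []] := zaP (T - t)%N t (subnKC tT) n.
have zaS n t : (t < T)%N ->
    za n t =1 backup lambda (rho t) (iota t) (c t) (za n t.+1).
  by move=> tT; have [_ [_]] := zaP (T - t)%N t (subnKC (ltnW tT)) n; exact.
have zetaT x : zeta T x = expR (- (lambda * cT x)).
  by rewrite decomp; apply: eq_bigr => n _; rewrite /za znT.
(* This is where the linearity of the recursion is used. *)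
have zetaS t x : (t < T)%N ->
    zeta t x = backup lambda (rho t) (iota t) (c t) (zeta t.+1) x.
  move=> tT; rewrite backup_sum//; [|exact: mc|by move=> ?; exact: c_ge0|].
    by apply: eq_bigr => n _; exact: zaS.
  by move=> n; exact: za_des.
have zeta_des t : (t <= T)%N -> is_desirability (zeta t).
  move=> /subnKC; move: (T - t)%N => k; elim: k t => [t|k IH t tkT].
    rewrite addn0 => ->; split => [|x]; last by rewrite zetaT expR_gt0/=.
    rewrite (funext zetaT); apply: measurableT_comp => //.
    by apply: measurableT_comp => //; exact: measurable_funM.
  have tT : (t < T)%N by rewrite -tkT addnS ltnS leq_addr.
  rewrite (_ : zeta t = backup lambda (rho t) (iota t) (c t) (zeta t.+1)).
    apply: is_desirability_backup => //; [exact: mc|by move=> ?; exact: c_ge0|].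
    by apply: IH; rewrite addSn -addnS.
  by apply/funext => x; exact: zetaS.
have zeta_gt0 t x : (t <= T)%N -> (0 < zeta t x)%R.
  by move=> /zeta_des[_ /(_ x)/andP[]].
have za_gt0 n t x : (t <= T)%N -> (0 < za n t x)%R.
  by move=> /(za_des n)[_ /(_ x)/andP[]].
have zE t x : (t <= T)%N ->
    desirability T lambda rho iota c cT t x = (zeta t x)%:E.
  by move=> tT; exact: desirability_soft.
move=> z w.
have wE n t x : (t <= T)%N -> w n t x = (za n t x / zeta t x)%:E.
  by move=> tT; rewrite /w /z zE// znE// inver gt_eqF ?zeta_gt0// -EFinM.
split.
  move=> t x tT; by have [->] := value_attained hlambda mc c_ge0 mcT cT_ge0
    zeta_des zetaT zetaS x tT.
split.
  move=> t x u tT; by have [->] := Q_attained hlambda mc c_ge0 mcT cT_ge0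
    zeta_des zetaT zetaS x u tT.
move=> t tT; split.
  move=> x; rewrite /z zE ?(ltnW tT)// -sumEFin.
  by apply: eq_bigr => n _; rewrite znE// ltnW.
split.
  move=> x; rewrite (eq_bigr (fun n => (za n t x / zeta t x)%:E)); last first.
    by move=> n _; rewrite wE// ltnW.
  by rewrite sumEFin -mulr_suml divff// gt_eqF// zeta_gt0// ltnW.
have ct0 xu : (0 <= c t xu)%R by exact: c_ge0.
have [n|pin pinE] := choice (P := fun n (p : R.-pker X ~> U) =>
    forall x A, measurable A -> p x A = \int[rho t x]_(u in A)
      (action_backup lambda (iota t) (c t) (za n t.+1) (x, u) / za n t x)%:E).
  have [p pE _] := backup_tilted_kernel (rho t) (iota t) hlambda (mc t tT) ct0
    (za_des n t.+1 tT).
  by exists p => x A mA; rewrite pE// zaS.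
have [pistar pistarE pistar_opt] := soft_policy_ex hlambda mc c_ge0 
  zeta_des zetaS tT.
exists pin, pistar; split.
- move=> n x A mA; rewrite pinE//; apply: eq_integral => u _.
  rewrite EFinM action_backupE//; last exact: za_des.
  rewrite znE ?(ltnW tT)// inver gt_eqF ?za_gt0 ?(ltnW tT)//.
  by congr (_ * _ * _); apply: eq_integral => y _; rewrite znE.
- exact: attains_soft_value_optimal pistar_opt.
- move=> pi pi_opt x A mA; rewrite pistarE//.
  exact: (optimal_policy_unique hlambda mc c_ge0 mcT cT_ge0 zeta_des zetaT
    zetaS tT pi_opt).
move=> x A mA; rewrite pistarE//.
have a_gt0 n u : (0 < action_backup lambda (iota t) (c t) (za n t.+1) (x, u))%R.
  by apply: action_backup_gt0; exact: za_des.
have ma n : measurable_fun [set: X * U]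
    (action_backup lambda (iota t) (c t) (za n t.+1)).
  by apply: measurable_action_backup => //; [exact: mc|exact: za_des].
(* The density of the optimal policy splits into [w_n] times the density of the
   n-th component policy. *)
transitivity (\int[rho t x]_(u in A) (\sum_(n < N)
    (action_backup lambda (iota t) (c t) (za n t.+1) (x, u) / zeta t x)%:E)).
  apply: eq_integral => u _; rewrite /action_desirability action_backup_sum//.
    by rewrite sumEFin mulr_suml.
  by move=> n; exact: za_des.
rewrite ge0_integral_sum//; last 2 first.
- move=> n; apply/measurable_EFinP; apply: measurable_funTS.
  by apply: measurable_funM => //; apply: measurableT_comp.
- by move=> n u _; rewrite lee_fin ltW// divr_gt0// zeta_gt0// ltnW.
apply: eq_bigr => n _; rewrite wE ?(ltnW tT)// pinE//.
have zt0 := zeta_gt0 t x (ltnW tT). have zat0 := za_gt0 n t x (ltnW tT).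
rewrite -ge0_integralZl_EFin ?divr_ge0 ?ltW//.
- apply: eq_integral => u _; rewrite -EFinM; congr (_%:E).
  by field; rewrite !gt_eqF.
- by move=> u _; rewrite lee_fin ltW// divr_gt0.
- apply/measurable_EFinP; apply: measurable_funTS.
  by apply: measurable_funM => //; apply: measurableT_comp.
Qed.
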